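(* Let $\ell\ge 2$ be an integer. If $G$ is a strongly connected digraph, then every directed cycle of $G$ has length a multiple of $\ell$ if and only if $G$ admits an $\ell$-ring.
   Context: A digraph is a finite directed graph without loops or parallel edges (directed cycles of length two are permitted); $uv$ denotes an edge from $u$ to $v$. A non-null digraph is strongly connected if for every two vertices $u,v$ there is a directed path from $u$ to $v$. An $\ell$-ring of $G$ is an ordered partition $(A_1,\ldots,A_\ell)$ of $V(G)$ (parts may be empty) such that for every edge $uv$ of $G$ there exists $i\in\{1,\ldots,\ell\}$ with $u\in A_i$ and $v\in A_{i+1}$ (subscripts modulo $\ell$). *)

(* Defs.v *)
From mathcomp Require Import all_boot.

Set Implicit Arguments.
Unset Strict Implicit.
Unset Printing Implicit Defensive.

(* Since edges form a relation there are no parallel edges; u -> v and v -> u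
   may both be present. The vertex set may be empty. *)
Record digraph := Digraph {
  vertex :> finType;
  edge : rel vertex;
  edge_irr : irreflexive edge
}.

Arguments edge {d} : rename.

(* u :: p is a directed path (no repeated vertex) from u to v; p = [::] gives
   the one-vertex path. *)
Definition dipath (G : digraph) (u v : G) (p : seq G) : Prop :=
  [/\ path edge u p, uniq (u :: p) & last u p = v].

Definition strongly_connected (G : digraph) : Prop :=
  0 < #|G| /\ forall u v : G, exists p : seq G, dipath u v p.

(* The cycle is given by its vertices in cyclic order, so its length is size c.
   The library's [ucycle] accepts the empty sequence, which is excluded here;
   sequences of size 1 are excluded by looplessness. *)
Definition dicycle (G : digraph) (c : seq G) : Prop :=
  c <> [::] /\ ucycle edge c.

(* Parts may be empty, so the library's [partition], which forbids empty
   blocks, does not apply. The parts are numbered from 0, and [ordS i] is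
   i + 1 modulo l. *)
Definition ordered_partition (T : finType) (l : nat) (A : 'I_l -> {set T}) :
    Prop :=
  (forall i j : 'I_l, i != j -> [disjoint A i & A j]) /\
  \bigcup_(i < l) A i = [set: T].

Definition is_ring (G : digraph) (l : nat) (A : 'I_l -> {set G}) : Prop :=
  ordered_partition A /\
  forall u v : G, edge u v -> exists i : 'I_l, u \in A i /\ v \in A (ordS i).

(* Main.v *)
Require Import Defs.
From mathcomp Require Import all_boot.

(** A closed walk splits into directed cycles, so all closed walks have length
    divisible by [l]. Hence the length modulo [l] of a walk from a fixed root
    to [v] depends on [v] only, and its residue classes form an [l]-ring.
    Conversely, in an [l]-ring each edge shifts the part index by one. *)

Lemma not_uniq_split {T : eqType} {s : seq T} :
  ~~ uniq s -> exists x s1 s2 s3, s = s1 ++ x :: s2 ++ x :: s3.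
Proof.
elim: s => [|y s IHs] //=; rewrite negb_and negbK => /orP[ys | /IHs].
  by case/splitPr: ys => s2 s3; exists y, [::], s2, s3.
by move=> [x [s1 [s2 [s3 ->]]]]; exists x, (y :: s1), s2, s3.
Qed.

Lemma cycle_cat_repeat (T : Type) (e : rel T) x (s1 s2 : seq T) :
  cycle e (x :: s1 ++ x :: s2) = cycle e (x :: s1) && cycle e (x :: s2).
Proof. by rewrite /= rcons_cat -cat_rcons cat_path last_rcons. Qed.

(** Strong induction on the length: a closed walk without repetition is empty or a directed cycle,
    and any other one is cut at a repeated vertex into two shorter closed walks. *)
Lemma dvdn_size_closed_walk {G : digraph} {l : nat} :
  (forall c : seq G, dicycle c -> l %| size c) ->
  forall c : seq G, cycle edge c -> l %| size c.
Proof.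
move=> dvd_l c; have [n] := ubnP (size c); elim: n c => // n IHn c.
rewrite ltnS => le_c_n cyc_c; have [uniq_c | ] := boolP (uniq c).
  case: c cyc_c uniq_c {le_c_n} => [|x c] cyc_c uniq_c; first exact: dvdn0.
  by apply: dvd_l; split=> //; apply/andP.
move=> /not_uniq_split[x [s1 [s2 [s3 def_c]]]].
(* Once the walk starts at [x], its second visit to [x] cuts it into two closed walks, each strictly
   shorter because the other contains [x]. *)
have rot_c : rot (size s1) c = x :: s2 ++ x :: (s3 ++ s1).
  by rewrite def_c rot_size_cat /= -catA.
move: cyc_c le_c_n; rewrite -(rot_cycle (size s1)) -(size_rot (size s1) c) rot_c.
rewrite cycle_cat_repeat -cat_cons size_cat => /andP[cyc1 cyc2] le_n.
by apply: dvdn_add; apply: IHn => //; apply: leq_trans le_n;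
  rewrite /= addSn addnS !ltnS ?leq_addl ?leq_addr.
Qed.

Lemma val_iter_ordS (l n : nat) (i : 'I_l) :
  iter n (@ordS l) i = (i + n) %% l :> nat.
Proof.
elim: n => [|n IHn] /=; first by rewrite addn0 modn_small.
by rewrite IHn -addn1 modnDml addn1 addnS.
Qed.

Lemma disjoint_index_inj {T : finType} {l : nat} {A : 'I_l -> {set T}} {x i j} :
  ordered_partition A -> x \in A i -> x \in A j -> i = j.
Proof.
move=> [disjA _] xAi xAj; have [//|/disjA/disjoint_setI0/setP/(_ x)] := eqVneq i j.
by rewrite !inE xAi xAj.
Qed.

Lemma ring_path {G : digraph} {l : nat} {A : 'I_l -> {set G}}
    {u : G} {p : seq G} {i : 'I_l} :
  is_ring A -> path edge u p -> u \in A i ->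
  last u p \in A (iter (size p) (@ordS l) i).
Proof.
move=> [partA edgeA]; elim: p u i => //= v p IHp u i /andP[/edgeA[j [uAj vA]]].
move=> path_p uAi; rewrite -iterS iterSr; apply: IHp => //.
by rewrite (disjoint_index_inj partA uAi uAj).
Qed.

(** Going once around from [x] in part [i] leads back to [x] in part [i + size c] modulo [l]; by
    disjointness the two indices agree. *)
Lemma ring_dvdn_size_cycle {G : digraph} {l : nat} {A : 'I_l -> {set G}}
    {c : seq G} :
  is_ring A -> cycle edge c -> l %| size c.
Proof.
move=> ringA; case: c => [|x p] /= cyc_p; first exact: dvdn0.
have [[partA covA] _] := ringA.
have /bigcupP[i _ xAi] : x \in \bigcup_(i < l) A i by rewrite covA inE.
have := ring_path ringA cyc_p xAi; rewrite last_rcons size_rcons => xAj.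
have := disjoint_index_inj ringA.1 xAi xAj.
move/(congr1 (@nat_of_ord l)); rewrite val_iter_ordS.
(* The bare index [i] becomes [(i + 0) %% l], so that [i] cancels from the congruence. *)
rewrite -{1}(modn_small (ltn_ord i)) -{1}[nat_of_ord i]addn0 => /esym/eqP.
by rewrite eqn_modDl mod0n.
Qed.

Lemma level_ring (G : digraph) (l : nat) (d : G -> nat) :
  0 < l -> (forall u v : G, edge u v -> d v = (d u).+1 %[mod l]) ->
  is_ring (fun i : 'I_l => [set v | d v %% l == i]).
Proof.
move=> l_gt0 d_edge; pose part v := Ordinal (ltn_pmod (d v) l_gt0).
split; [split | ].
- move=> i j neq_ij; apply/pred0P=> v; apply: contraNF neq_ij.
  by rewrite /= !inE => /andP[/eqP di /eqP dj]; apply/eqP/val_inj; rewrite /= -di.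
- by apply/setP=> v; rewrite inE; apply/bigcupP; exists (part v); rewrite ?inE.
move=> u v /d_edge d_uv; exists (part u); rewrite !inE eqxx; split=> //=.
by rewrite d_uv -addn1 -modnDml addn1.
Qed.

(** For an edge [u v], a single path [q] from [v] back to the root [r] closes both the chosen path
    to [v] and the chosen path to [u] extended by the edge; comparing the two lengths modulo [l]
    gives the hypothesis of [level_ring]. *)
Lemma closed_walks_ring {G : digraph} {l : nat} :
  0 < l -> strongly_connected G ->
  (forall c : seq G, cycle edge c -> l %| size c) ->
  exists A : 'I_l -> {set G}, is_ring A.
Proof.
move=> l_gt0 [/card_gt0P[r _] strG] dvd_l.
have /fin_all_exists[w walk_w] (v : G) := strG r v.
(* Here [p] omits the initial [r] but keeps the final one, so [size p] is the number of edges. *)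
have closed_walk p : path edge r p -> last r p = r -> l %| size p.
  case/lastP: p => [|p x]; first by rewrite dvdn0.
  by rewrite last_rcons size_rcons => + xr; rewrite xr; apply: (dvd_l (r :: p)).
exists (fun i : 'I_l => [set v | size (w v) %% l == i]).
apply: (level_ring _ _ (size \o w)) => // u v uv; have [q [path_q _ last_q]] := strG v r.
have [path_u _ last_u] := walk_w u; have [path_v _ last_v] := walk_w v.
have dvd_v : l %| size (w v ++ q).
  by apply: closed_walk; rewrite ?cat_path ?last_cat last_v ?path_v.
have dvd_u : l %| size (w u ++ v :: q).
  by apply: closed_walk; rewrite ?cat_path ?last_cat last_u //= path_u uv.
(* Adding [size q] turns the two sides into the lengths of the two closed walks, both 0 modulo
   [l]. *)
apply/eqP; rewrite /= -(eqn_modDr (size q)) addSnnS -!size_cat.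
by rewrite -[size (w u) + _](size_cat (w u) (v :: q)) (eqP dvd_u) (eqP dvd_v).
Qed.

Theorem mainTheorem5 (l : nat) (hl : 2 <= l) (G : digraph)
    (hG : strongly_connected G) :
  (forall c : seq G, dicycle c -> l %| size c) <->
  (exists A : 'I_l -> {set G}, is_ring A).
Proof.
split=> [/dvdn_size_closed_walk dvd_l | [A ringA] c [_ /andP[cyc_c _]]].
  exact: closed_walks_ring (ltnW hl) hG dvd_l.
exact: ring_dvdn_size_cycle ringA cyc_c.
Qed.
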